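(* Suppose that the distribution function of $\varphi$ is continuous and strictly increasing on $(0,\infty)$, and let $\lambda\in(0,1)$, $v\in(0,K)$. Then the Neyman–Pearson problem for $\widehat\rho_\lambda$ with capital constraint $v$ has a ($P$-a.s.) unique solution $X^*$, which is $P$-a.s. of the form $$X^*=\alpha+\bigl(I(\gamma(\varphi\vee z))-I(\gamma z)\bigr)\wedge(K-\alpha),$$ where $\alpha$, $z$ and $\gamma$ are constants such that $0\le\alpha<v$, $z\ge q$ and $\gamma=\ell'(\alpha-R(v))/z$. Moreover, for every $\lambda\in(0,1)$ there exists a critical value $\widehat v_\lambda\in(0,K)$ such that $\alpha=0$ if $v\le\widehat v_\lambda$.
   Context: $(\Omega,\mathcal F,P)$ is an atomless probability space, $K>0$ is a constant, and the price density $\varphi$ is a random variable, unbounded from above, with $\varphi>0$ $P$-a.s. and $E[\varphi]=1$. Notation: $x\vee y=\max$, $x\wedge y=\min$. The loss function $\ell:\mathbb R\to\mathbb R$ is strictly increasing, strictly convex and continuously differentiable. Its derivative $\ell'$ is a bijection from $\mathbb R$ onto some interval $(a,b)\subset(0,\infty)$, and its inverse is extended to $\mathbb R$ by $I(x)=+\infty$ for $x\ge b$, $I(x)=(\ell')^{-1}(x)$ for $a<x<b$, and $I(x)=-\infty$ for $x\le a$. $x_0$ is a fixed interior point of $\ell(\mathbb R)$. For $\lambda\in(0,1]$, $\mathcal Q_\lambda$ is the set of probability measures $Q\ll P$ with $dQ/dP\le1/\lambda$ $P$-a.s., and for $X\in L^\infty(\Omega,\mathcal F,P)$ $$\widehat\rho_\lambda(-X)=\inf\Bigl\{m\in\mathbb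 R\ \Big|\ \max_{Q\in\mathcal Q_\lambda}E_Q[\ell(X-m)]\le x_0\Bigr\}.$$ Let $q:=q_\varphi(1-\lambda)$ be the $(1-\lambda)$-quantile of $\varphi$ under $P$. The Neyman–Pearson problem for $\widehat\rho_\lambda$ with capital constraint $v$ is: minimize $\widehat\rho_\lambda(-X)$ over all random variables $X$ with $0\le X\le K$ and $E[\varphi X]\ge v$. Its minimal value is denoted $R(v)$. *)

(* Defs.v *)
From HB Require Import structures.
From mathcomp Require Import all_boot all_order all_algebra.
From mathcomp Require Import all_classical all_reals all_analysis.

Set Implicit Arguments.
Unset Strict Implicit.
Unset Printing Implicit Defensive.

Import Order.TTheory GRing.Theory Num.Theory.
Import numFieldNormedType.Exports.

Local Open Scope classical_set_scope.
Local Open Scope ring_scope.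

Definition atomless (d : measure_display) (T : measurableType d)
    (R : realType) (P : probability T R) : Prop :=
  forall A : set T, measurable A -> (0 < P A)%E ->
    exists B : set T, [/\ measurable B, B `<=` A, (0 < P B)%E & (P B < P A)%E].

(* Lower quantile. When the distribution function is continuous and strictly
   increasing on (0, +oo) and X > 0 a.s., all t-quantiles with 0 < t < 1
   coincide. *)
Definition quantile (d : measure_display) (T : measurableType d)
    (R : realType) (P : probability T R) (X : {RV P >-> R}) (t : R) : R :=
  inf [set x : R | (t%:E <= cdf X x)%E].

Definition strictly_convex (R : realType) (f : R -> R) : Prop :=
  forall x y t : R, x != y -> 0 < t -> t < 1 ->
    f (t * x + (1 - t) * y) < t * f x + (1 - t) * f y.

(* The upper end b of the range (a, b) of ell' may be +oo. *)
Definition loss_function (R : realType) (ell : R -> R) (a : R) (b : \bar R)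
    : Prop :=
  [/\ {homo ell : x y / x < y},
      strictly_convex ell,
      (forall x : R, derivable ell x 1) /\ continuous ell^`()%classic,
      0 <= a &
      set_bij [set: R] [set x : R | a < x /\ (x%:E < b)%E] ell^`()%classic].

Definition ext_inverse (R : realType) (ell : R -> R) (a : R) (b : \bar R)
    (x : R) : \bar R :=
  if (b <= x%:E)%E then +oo%E
  else if x <= a then -oo%E
  else (pinv [set: R] ell^`()%classic x)%:E.

Definition Qset (d : measure_display) (T : measurableType d)
    (R : realType) (P : probability T R) (lambda : R)
    : set (probability T R) :=
  [set Q : probability T R | Q `<< P /\
    {ae P, forall w,
      (Radon_Nikodym (charge_of_finite_measure Q) P w <= (lambda^-1)%:E)%E}].

(* rho_hat Y is the risk of the position Y, i.e. Y = - X for a loss X.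
   The supremum over Q is attained for bounded Y, so it is a maximum;
   the set of m is then nonempty and bounded below when x0 is an interior
   point of the range of ell. *)
Definition rho_hat (d : measure_display) (T : measurableType d)
    (R : realType) (P : probability T R) (ell : R -> R) (x0 lambda : R)
    (Y : T -> R) : R :=
  inf [set m : R |
    (ereal_sup [set 'E_Q[(fun w => (ell (- Y w - m))%R)] | Q in Qset P lambda]
       <= x0%:E)%E].

Definition NP_admissible (d : measure_display) (T : measurableType d)
    (R : realType) (P : probability T R) (phi : {RV P >-> R}) (K v : R)
    : set {RV P >-> R} :=
  [set X : {RV P >-> R} |
    (forall w, 0 <= X w <= K) /\ (v%:E <= 'E_P[(fun w => (phi w * X w)%R)])%E].

Definition NP_solution (d : measure_display) (T : measurableType d)
    (R : realType) (P : probability T R) (phi : {RV P >-> R}) (ell : R -> R)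
    (x0 lambda K v : R) (X : {RV P >-> R}) : Prop :=
  NP_admissible phi K v X /\
  forall Y : {RV P >-> R}, NP_admissible phi K v Y ->
    rho_hat P ell x0 lambda (fun w => - X w)
      <= rho_hat P ell x0 lambda (fun w => - Y w).

Definition NP_value (d : measure_display) (T : measurableType d)
    (R : realType) (P : probability T R) (phi : {RV P >-> R}) (ell : R -> R)
    (x0 lambda K v : R) : R :=
  inf [set rho_hat P ell x0 lambda (fun w => - X w) |
        X in NP_admissible phi K v].

(* X = alpha + (I (gamma (phi \/ z)) - I (gamma z)) /\ (K - alpha), P-a.s.,
   computed in the extended reals since I may take the value +oo; the
   subtracted term I (gamma z) is finite because gamma z lies in the range
   of ell'. *)
Definition NP_form (d : measure_display) (T : measurableType d)
    (R : realType) (P : probability T R) (phi : {RV P >-> R}) (ell : R -> R)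
    (a : R) (b : \bar R) (x0 lambda K v : R) (X : {RV P >-> R})
    (alpha z gamma : R) : Prop :=
  let I := ext_inverse ell a b in
  [/\ 0 <= alpha < v,
      quantile phi (1 - lambda) <= z,
      gamma = ell^`()%classic (alpha - NP_value phi ell x0 lambda K v) / z &
      {ae P, forall w, (X w)%:E =
        (alpha%:E + Order.min (I (gamma * Num.max (phi w) z)%R - I (gamma * z)%R)
                              (K - alpha)%R%:E)%E}].

(* Main.v *)
Require Import Defs.
From HB Require Import structures.
From mathcomp Require Import all_boot all_order all_algebra.
From mathcomp Require Import all_classical all_reals all_analysis.
From mathcomp Require Import measurable_realfun ess_sup_inf lra ring.

(** The supremum over [Qset P lambda] can be replaced by one measure. Let
    [z > 0] solve [E[phi /\ z] = lambda z] and let [Q] have the density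
    [D = (phi /\ z) / (lambda z)], which is at most [1 / lambda]. Because
    [phi = lambda D (phi \/ z)], minimizing
    [E[D ell(X - m)] - (gamma / lambda) E[phi X]] over [0 <= X <= K] amounts to
    minimizing [ell(x - m) - gamma (phi(w) \/ z) x] over [0 <= x <= K] at each
    point [w]. The minimizer [claim gamma m] is [m + I(gamma (phi \/ z))] cut
    off at [0] and [K]; it is unique by strict convexity. As a nondecreasing
    function of [phi \/ z], it takes its smallest value on all of [phi <= z],
    and [D] takes its largest possible value [1 / lambda] on [phi >= z]: so no
    measure of the class gives the loss [ell(claim gamma m - m)] a larger mean
    than [Q] does ([acceptable_claim]). Thus [Q] and [claim gamma m] form a
    saddle point, and [claim gamma m] is optimal as soon as its mean loss under
    [Q] is [x0] and its price is [v] ([claim_solution], [claim_value],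
    [claim_unique]).

    Both multipliers come from the intermediate value theorem. The mean loss
    [risk gamma m] is continuous and strictly decreasing in [m], so each
    [gamma] has exactly one [m] with [risk gamma m = x0]; it depends
    continuously and monotonically on [gamma] ([capital_path]). Along this
    path the price of the claim moves continuously from [0], at [gamma = 0], to
    [K] ([revenue_onto]).

    If the cut-off at [0] is active, then the claim vanishes up to the level
    [ell'(- m) / gamma] of [phi]; writing the maximum of this level and [z] for
    the constant of the theorem gives the announced form ([claim_form]), with
    [alpha] the value on [phi <= z]. Finally [alpha = 0] whenever
    [gamma z <= ell'(- m)], hence for all small [gamma], that is for all
    small [v]: prices and claims increase together along the path
    ([floor_value_mono0]). *)

Set Implicit Arguments.
Unset Strict Implicit.
Unset Printing Implicit Defensive.

Import Order.TTheory GRing.Theory Num.Theory.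
Import numFieldNormedType.Exports.

Local Open Scope classical_set_scope.
Local Open Scope ring_scope.

(** * Convex loss functions *)

Section loss.
Context (R : realType) (ell : R -> R) (a : R) (b : \bar R).
Hypothesis Hl : loss_function ell a b.

Local Notation g := (ell^`()%classic).

Lemma loss_derivable x : derivable ell x 1.
Proof. by case: Hl => _ _ [+ _] _ _; exact. Qed.

Lemma loss_continuous : continuous ell.
Proof.
by move=> x; apply/differentiable_continuous/derivable1_diffP/loss_derivable.
Qed.

Lemma loss_mono : {mono ell : x y / x <= y}.
Proof. by case: Hl => incr *; exact: le_mono. Qed.

Lemma loss_tangent_le x y : ell x + g x * (y - x) <= ell y.
Proof.
have [<-|xy] := eqVneq x y; first by rewrite subrr mulr0 addr0.
have Hc : strictly_convex ell by case: Hl.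
have dif : differentiable ell x by exact/derivable1_diffP/loss_derivable.
have dv : 'D_(y - x) ell x = (y - x) * g x by rewrite deriveE// diff1E.
have /cvg_dnbhs_at_right : (fun h : R => h^-1 *:
    ((ell \o shift x) (h *: (y - x)) - ell x)) @ 0^' --> (y - x) * g x.
  by rewrite -dv; exact: (@diff_derivable _ _ _ ell x (y - x) dif).
move=> /cvgr_to_le H; rewrite addrC -lerBrDr mulrC; apply: H.
near=> t; have t0 : 0 < t by near: t; exact: nbhs_right_gt.
have t1 : t < 1 by near: t; exact: nbhs_right_lt.
rewrite /= [_ *: _]/(_ * _) [t *: _]/(_ * _) ler_pdivrMl//.
have := Hc y x t; rewrite eq_sym => /(_ xy t0 t1).
have -> : t * y + (1 - t) * x = t * (y - x) + x by ring.
lra.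
Unshelve. all: by end_near. Qed.

(** The supporting line at [x] already lies weakly below the graph at the
    midpoint of [x] and [y], where convexity is strict. *)
Lemma loss_tangent_lt x y : x != y -> ell x + g x * (y - x) < ell y.
Proof.
move=> xy; have Hc : strictly_convex ell by case: Hl.
have := Hc x y 2^-1 xy; have h2 : (0 : R) < 2^-1 by rewrite invr_gt0.
move=> /(_ h2) H; have /H : (2^-1 : R) < 1 by rewrite invf_lt1// ltr1n.
have := loss_tangent_le x (2^-1 * x + (1 - 2^-1) * y).
have -> : 2^-1 * x + (1 - 2^-1) * y - x = 2^-1 * (y - x) by field.
lra.
Qed.

Lemma dloss_mono : {mono g : x y / x <= y}.
Proof.
apply: le_mono => x y xy.
have := loss_tangent_lt (negbT (lt_eqF xy)).
have := loss_tangent_lt (negbT (gt_eqF xy)).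
by rewrite -subr_gt0 in xy; nra.
Qed.

Lemma dloss_range x : a < g x /\ ((g x)%:E < b)%E.
Proof. by case: Hl => _ _ _ _ [+ _ _]; exact. Qed.

Lemma dloss_gt0 x : 0 < g x.
Proof.
case: Hl => _ _ _ a0 _; apply: le_lt_trans a0 _.
by case: (dloss_range x).
Qed.

Lemma inv_dlossK y : a < y -> (y%:E < b)%E -> g (pinv setT g y) = y.
Proof.
move=> ay yb; case: Hl => _ _ _ _ [_ _ sg].
by apply: pinvK; rewrite inE; apply: sg.
Qed.

Lemma dlossK x : pinv setT g (g x) = x.
Proof.
apply: pinvKV; last by rewrite inE.
by move=> u v _ _; exact: (inc_inj dloss_mono).
Qed.

(** The minimizer of [fun x => ell x - y * x] over the interval from [lo] to
    [hi]: the stationary point where [ell' x = y], moved to the nearer endpoint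
    when it lies outside. Clipping [y] instead of the inverse avoids the
    infinite values of the latter. *)
Definition clipped_inverse (lo hi y : R) : R :=
  pinv setT g (Num.min (Num.max y (g lo)) (g hi)).

Local Notation J := clipped_inverse.

Lemma dloss_clipped (lo hi y : R) : lo <= hi ->
  g (J lo hi y) = Num.min (Num.max y (g lo)) (g hi).
Proof.
move=> lohi; have [al _] := dloss_range lo; have [_ hb] := dloss_range hi.
apply: inv_dlossK.
  by rewrite lt_min lt_max al orbT (lt_le_trans al)// dloss_mono.
by apply: le_lt_trans hb; rewrite lee_fin ge_min lexx orbT.
Qed.

Lemma clipped_lt (lo hi y t : R) : lo <= hi ->
  (J lo hi y < t) = (y < g t) && (lo < t) || (hi < t).
Proof.
move=> lohi; rewrite -(leW_mono dloss_mono (J lo hi y)) dloss_clipped//.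
by rewrite gt_min gt_max !(leW_mono dloss_mono).
Qed.

Lemma clipped_gt (lo hi y t : R) : lo <= hi ->
  (t < J lo hi y) = ((g t < y) || (t < lo)) && (t < hi).
Proof.
move=> lohi; rewrite -(leW_mono dloss_mono t (J lo hi y)) dloss_clipped//.
by rewrite lt_min lt_max !(leW_mono dloss_mono).
Qed.

Lemma clipped_ge lo hi y : lo <= hi -> lo <= J lo hi y.
Proof. by move=> lohi; rewrite leNgt clipped_lt// ltxx andbF/= -leNgt. Qed.

Lemma clipped_le lo hi y : lo <= hi -> J lo hi y <= hi.
Proof. by move=> lohi; rewrite leNgt clipped_gt// ltxx andbF. Qed.

Lemma clipped_homo lo hi lo' hi' y y' : lo <= hi -> lo' <= hi' ->
  lo <= lo' -> hi <= hi' -> y <= y' -> J lo hi y <= J lo' hi' y'.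
Proof.
move=> lohi lohi' ll hh yy; rewrite -dloss_mono !dloss_clipped//.
rewrite le_min !ge_min ge_max !le_max !dloss_mono ll hh yy !orbT.
by rewrite ?orbT.
Qed.

Lemma clipped_low lo hi y : lo <= hi -> y <= g lo -> J lo hi y = lo.
Proof.
move=> lohi ylo; rewrite /J (max_idPr ylo) min_l ?dloss_mono//; exact: dlossK.
Qed.

(** Moving the interval down by [t] lowers the minimizer by at most [t]. This
    makes the claims below increase with the capital [m]. *)
Lemma clipped_shift lo hi y t : lo <= hi -> 0 <= t ->
  J lo hi y <= t + J (lo - t) (hi - t) y.
Proof.
move=> lohi t0; have lohi' : lo - t <= hi - t by rewrite lerD2r.
rewrite -lerBlDl leNgt clipped_lt// !ltrBlDr !subrK.
apply/negP => /orP[/andP[yg loJ]|]; last by rewrite ltNge clipped_le.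
have : y < g (J lo hi y) by rewrite (lt_le_trans yg)// dloss_mono gerBl.
rewrite dloss_clipped// lt_min lt_max ltxx/= => /andP[ylo _].
by move: loJ; rewrite clipped_low ?ltxx// ltW.
Qed.

Lemma clipped_high lo hi y : lo <= hi -> g hi <= y -> J lo hi y = hi.
Proof.
move=> lohi ylo; rewrite /J min_r ?le_max ?ylo//; exact: dlossK.
Qed.

(** [clipped_lt] and [clipped_gt] express the strict bounds on the minimizer as
    strict, hence open, conditions on [lo], [hi] and [y]. *)
Lemma clipped_cvg {U : Type} (F : set_system U) {FF : Filter F}
    (lo_ hi_ y_ : U -> R) lo hi y :
  (forall u, lo_ u <= hi_ u) -> lo <= hi ->
  lo_ @ F --> lo -> hi_ @ F --> hi -> y_ @ F --> y ->
  (fun u => J (lo_ u) (hi_ u) (y_ u)) @ F --> J lo hi y.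
Proof.
move=> lohi_ lohi clo chi cy; apply/cvgrPdist_lt => e e0.
have A : \forall u \near F, J (lo_ u) (hi_ u) (y_ u) < J lo hi y + e.
  have : J lo hi y < J lo hi y + e by rewrite ltrDl.
  rewrite clipped_lt// => /orP[/andP[h1 h2]|h].
    near=> u; rewrite clipped_lt//; apply/orP; left; apply/andP; split; near: u.
    - exact: cvgr_lt h1.
    - exact: cvgr_lt h2.
  near=> u; rewrite clipped_lt//; apply/orP; right; near: u; exact: cvgr_lt h.
have B : \forall u \near F, J lo hi y - e < J (lo_ u) (hi_ u) (y_ u).
  have : J lo hi y - e < J lo hi y by rewrite gtrBl.
  rewrite clipped_gt// => /andP[/orP h1 h2]; case: h1 => h1.
    near=> u; rewrite clipped_gt//; apply/andP; split; last first.
      by near: u; exact: cvgr_gt h2.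
    apply/orP; left; near: u; exact: cvgr_gt h1.
  near=> u; rewrite clipped_gt//; apply/andP; split; last first.
    by near: u; exact: cvgr_gt h2.
  apply/orP; right; near: u; exact: cvgr_gt h1.
near=> u; rewrite distrC ltr_distl; apply/andP; split; near: u => //.
Unshelve. all: by end_near. Qed.

(** First-order optimality of the minimizer on the interval. *)
Lemma clipped_projection lo hi y x : lo <= x <= hi ->
  0 <= (g (J lo hi y) - y) * (x - J lo hi y).
Proof.
move=> /andP[lox xhi]; have lohi := le_trans lox xhi.
have [ylo|ylo] := leP y (g lo).
  by rewrite clipped_low// mulr_ge0 ?subr_ge0.
have [hiy|hiy] := leP (g hi) y.
  by rewrite clipped_high// mulr_le0 ?subr_le0.
rewrite dloss_clipped// max_l ?(ltW ylo)// min_l ?(ltW hiy)//.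
by rewrite subrr mul0r.
Qed.

Lemma loss_bound lo hi x : lo <= x <= hi -> `|ell x| <= `|ell lo| + `|ell hi|.
Proof.
rewrite -(loss_mono lo x) -(loss_mono x hi) => /andP[h1 h2].
have := ler_norm (ell hi); have := lerNnormlW (lexx `|ell lo|).
have := normr_ge0 (ell hi); have := normr_ge0 (ell lo).
by rewrite ler_norml; lra.
Qed.

End loss.

(** * Integration and bounded densities *)

Section integration.
Context (R : realType) (d : measure_display) (T : measurableType d).
Context (P : probability T R).
Implicit Types (f h D : T -> R) (C lambda : R).

Lemma bounded_integrable f C : measurable_fun [set: T] f ->
  (forall w, `|f w| <= C) -> P.-integrable [set: T] (EFin \o f).
Proof.
move=> mf fC; apply: (@le_integrable _ _ _ P _ measurableT _ (cst C%:E)).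
- exact/measurable_EFinP.
- by move=> w _ /=; rewrite lee_fin (le_trans (fC w))// ler_norm.
- exact: finite_measure_integrable_cst.
Qed.

Lemma integrable_scale k f : P.-integrable [set: T] (EFin \o f) ->
  P.-integrable [set: T] (EFin \o (fun w => k * f w)).
Proof. exact: (@integrableZl _ _ _ P setT measurableT k (EFin \o f)). Qed.

Lemma integrable_sub f h : P.-integrable [set: T] (EFin \o f) ->
  P.-integrable [set: T] (EFin \o h) ->
  P.-integrable [set: T] (EFin \o (fun w => f w - h w)).
Proof.
exact: (@integrableB _ _ _ P setT measurableT (EFin \o f) (EFin \o h)).
Qed.

Lemma EFin_Rintegral f : P.-integrable [set: T] (EFin \o f) ->
  (\int[P]_w (f w)%:E)%E = (\int[P]_w f w)%:E.
Proof. by move=> fi; rewrite /Rintegral fineK//; exact: integrable_fin_num. Qed.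

Lemma ae_ge0_Rintegral f : P.-integrable [set: T] (EFin \o f) ->
  {ae P, forall w, 0 <= f w} -> 0 <= \int[P]_w f w.
Proof.
move=> fi f0; rewrite /Rintegral.
rewrite (@ae_eq_integral _ _ _ P setT (fun w => `|f w|%:E)).
- by apply: fine_ge0; apply: integral_ge0 => w _; rewrite lee_fin.
- exact: measurableT.
- exact: measurable_int fi.
- have /measurable_EFinP := measurable_int _ fi.
  by move=> mf; apply/measurable_EFinP; exact: measurableT_comp.
- by apply: filterS f0 => w fw _; rewrite ger0_norm.
Qed.

Lemma ae_ge0_Rintegral_eq0 f : P.-integrable [set: T] (EFin \o f) ->
  {ae P, forall w, 0 <= f w} -> \int[P]_w f w <= 0 ->
  {ae P, forall w, f w = 0}.
Proof.
move=> fi f0 I0; have mf := measurable_int _ fi.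
have E : (\int[P]_w `|(EFin \o f) w| = 0)%E.
  rewrite (@ae_eq_integral _ _ _ P setT (fun w => (f w)%:E)).
  - rewrite EFin_Rintegral//; congr EFin; apply/eqP; rewrite eq_le I0/=.
    exact: ae_ge0_Rintegral.
  - exact: measurableT.
  - exact: measurableT_comp.
  - exact: mf.
  - by apply: filterS f0 => w fw _ /=; rewrite ger0_norm.
have /ae_eq_integral_abs : measurable_fun [set: T] (EFin \o f) by [].
move=> /(_ P measurableT)[/(_ E) H _].
by apply: filterS H => w /(_ I)/= [].
Qed.

Lemma Qset_expectation_le lambda (Q : probability T R) f C :
  0 < lambda -> Qset P lambda Q -> measurable_fun [set: T] f ->
  (forall w, 0 <= f w <= C) ->
  ('E_Q[f] <= (lambda^-1 * \int[P]_w f w)%:E)%E.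
Proof.
move=> l0 [QP RN] mf fC.
have fn w : `|f w| <= C by have /andP[f0 fc] := fC w; rewrite ger0_norm.
have fP := bounded_integrable mf fn.
rewrite unlock -(@Radon_Nikodym_change_of_variables _ _ _ Q P QP)//; last first.
  apply: (@le_integrable _ _ _ Q _ measurableT _ (cst C%:E)).
  - exact/measurable_EFinP.
  - by move=> w _ /=; rewrite lee_fin (le_trans (fn w))// ler_norm.
  - exact: finite_measure_integrable_cst.
pose RNQ := Radon_Nikodym (charge_of_finite_measure Q) P.
pose r w := fine (RNQ w).
have rE : EFin \o r = RNQ.
  by apply/funext => w; rewrite /r/= fineK//; exact: Radon_Nikodym_fin_num.
have ri : P.-integrable [set: T] (EFin \o r).
  by rewrite rE; exact: Radon_Nikodym_integrable.
have mr : measurable_fun [set: T] r.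
  exact/measurable_EFinP/(measurable_int _ ri).
have fri : P.-integrable [set: T] (EFin \o (fun w => f w * r w)).
  apply: (@le_integrable _ _ _ P _ measurableT _ (EFin \o (fun w => C * r w))).
  - by apply/measurable_EFinP; exact: measurable_funM.
  - move=> w _ /=; rewrite lee_fin !normrM ler_wpM2r//.
    exact: le_trans (fn w) (ler_norm _).
  - exact: integrable_scale.
have -> : (\int[P]_w ((f w)%:E * RNQ w) = (\int[P]_w (f w * r w)%R)%:E)%E.
  rewrite -EFin_Rintegral//; apply: eq_integral => w _ /=.
  by rewrite EFinM -[r w]/(fine _) fineK//; exact: Radon_Nikodym_fin_num.
have lfi : P.-integrable [set: T] (EFin \o (fun w => lambda^-1 * f w)).
  exact: integrable_scale.
rewrite lee_fin -RintegralZl// -subr_ge0 -RintegralB//.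
apply: ae_ge0_Rintegral; first exact: integrable_sub.
apply: filterS RN => w; rewrite -[Radon_Nikodym _ _ _]fineK; last first.
  exact: Radon_Nikodym_fin_num.
rewrite lee_fin -/(r w) => rl; rewrite subr_ge0 mulrC ler_wpM2r//.
by case/andP: (fC w).
Qed.

(** Any density bounded by [1 / lambda] is the Radon-Nikodym derivative of a
    measure of the class, so expectations under it are weighted integrals. *)
Lemma density_probability lambda D : 0 < lambda -> measurable_fun [set: T] D ->
  (forall w, 0 <= D w <= lambda^-1) -> \int[P]_w D w = 1 ->
  exists2 Q : probability T R, Qset P lambda Q &
    forall f C, measurable_fun [set: T] f -> (forall w, `|f w| <= C) ->
      ('E_Q[f] = (\int[P]_w (D w * f w)%R)%:E)%E.
Proof.
move=> l0 mD D01 D1.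
have D0 w : 0 <= D w by case/andP: (D01 w).
have mDE : measurable_fun [set: T] (EFin \o D) by exact/measurable_EFinP.
have Dn w : `|D w| <= lambda^-1 by rewrite ger0_norm//; case/andP: (D01 w).
have Di := bounded_integrable mD Dn.
pose nu (A : set T) : \bar R := (\int[P]_(w in A) (D w)%:E)%E.
have nu0 : nu set0 = 0%E by rewrite /nu integral_set0.
have nuge0 A : (0 <= nu A)%E by apply: integral_ge0 => w _; rewrite lee_fin.
have nus : semi_sigma_additive nu.
  by apply: semi_sigma_additive_nng_induced => // w; rewrite lee_fin.
pose nuM : {measure set T -> \bar R} :=
  HB.pack nu (isMeasure.Build _ _ _ nu nu0 nuge0 nus).
have nuT : nuM setT = 1%E by rewrite -D1 -EFin_Rintegral.
pose Q : probability T R :=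
  HB.pack nu (isMeasure.Build _ _ _ nu nu0 nuge0 nus)
    (Measure_isProbability.Build _ _ _ nuM nuT).
have QE A : Q A = nu A by [].
have QP : Q `<< P.
  apply/null_content_dominatesP => A mA PA; rewrite QE.
  by apply: null_set_integral => //; exact: measurable_funTS.
pose RNQ := Radon_Nikodym (charge_of_finite_measure Q) P.
have RNi : P.-integrable [set: T] RNQ by exact: Radon_Nikodym_integrable.
have RND : ae_eq P setT RNQ (EFin \o D).
  apply: integral_ae_eq => // A _ mA; rewrite -Radon_Nikodym_integral//.
exists Q.
  split=> //; apply: filterS RND => w /(_ I) H; rewrite [leLHS]H/=.
  by rewrite lee_fin; case/andP: (D01 w).
move=> f C mf fC.
have fQ : Q.-integrable [set: T] (EFin \o f).
  apply: (@le_integrable _ _ _ Q _ measurableT _ (cst C%:E)).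
  - exact/measurable_EFinP.
  - by move=> w _ /=; rewrite lee_fin (le_trans (fC w))// ler_norm.
  - exact: finite_measure_integrable_cst.
rewrite unlock -(@Radon_Nikodym_change_of_variables _ _ _ Q P QP)//.
rewrite -EFin_Rintegral; last first.
  apply: (@bounded_integrable _ (lambda^-1 * C)); first exact: measurable_funM.
  by move=> w; rewrite normrM ler_pM.
apply: ae_eq_integral => //.
- apply: emeasurable_funM; first exact/measurable_EFinP.
  exact: measurable_int RNi.
- by apply/measurable_EFinP; exact: measurable_funM.
- by apply: filterS RND => w H /H E; rewrite EFinM -[(D w)%:E]E muleC.
Qed.

End integration.

(** * Parametric integrals and implicit functions *)

Lemma continuous_Rintegral (R : realType) (d : measure_display)
    (T : measurableType d) (P : probability T R) (f : R -> T -> R)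
    (h : R -> T -> R) :
  (forall t, measurable_fun [set: T] (f t)) ->
  (forall w, continuous (f ^~ w)) ->
  (forall c, P.-integrable [set: T] (EFin \o h c)) ->
  (forall c t w, c - 1 < t -> t < c + 1 -> `|f t w| <= h c w) ->
  continuous (fun t => \int[P]_w f t w).
Proof.
move=> mf cf ih fh c.
have ci : c \in ([set` `]c - 1, c + 1[] : set R).
  by rewrite inE/= in_itv/=; lra.
apply: (@continuity_under_integral R _ _ P f setT measurableT (c - 1) (c + 1)
          _ _ (h c) _ _ c ci).
- move=> t /= /[!in_itv]/= /andP[t1 t2].
  apply: (@le_integrable _ _ _ P _ measurableT _ (EFin \o h c)) => //.
    exact/measurable_EFinP.
  by move=> w _ /=; rewrite lee_fin (le_trans (fh _ _ _ t1 t2))// ler_norm.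
- by apply: aeW => w _ t _; exact: cf.
- exact: ih.
- by move=> t /= /[!in_itv]/= /andP[t1 t2]; apply: aeW => w _; exact: fh.
Qed.

(** Strict monotonicity in the second variable turns the closeness of [f x'] to
    [f x] into two strict inequalities for [F x'] at fixed second argument. *)
Lemma implicit_function_continuous (R : realType) (F : R -> R -> R) (f : R -> R)
    (c : R) :
  (forall y, continuous (F ^~ y)) ->
  (forall x, {homo F x : y y' / y < y' >-> y' < y}) ->
  (forall x, F x (f x) = c) -> continuous f.
Proof.
move=> Fc Fd Ff x; apply/cvgrPdist_lt => e e0.
have h1 : F x (f x + e) < c by rewrite -[ltRHS](Ff x); apply: Fd; rewrite ltrDl.
have h2 : c < F x (f x - e) by rewrite -[ltLHS](Ff x); apply: Fd; rewrite gtrBl.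
have Fm x' y y' : F x' y < F x' y' -> y' < y.
  move=> h; rewrite ltNge; apply: contraTN h.
  by rewrite le_eqVlt -leNgt => /orP[/eqP->//|/Fd/ltW].
near=> x'; rewrite distrC ltr_distl; apply/andP; split.
  apply: (Fm x'); rewrite Ff; near: x'.
  exact: (cvgr_gt (f := F ^~ (f x - e)) _ (Fc _ x) _ h2).
apply: (Fm x'); rewrite Ff; near: x'.
exact: (cvgr_lt (f := F ^~ (f x + e)) _ (Fc _ x) _ h1).
Unshelve. all: by end_near. Qed.

(** * The optimal claims *)

Section family.
Context (R : realType) (d : measure_display) (T : measurableType d).
Context (P : probability T R) (phi : {RV P >-> R}).
Context (ell : R -> R) (a : R) (b : \bar R) (K lambda z : R).
Implicit Types (f Y : T -> R) (C m gamma t x y : R) (w : T).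
Hypothesis Hl : loss_function ell a b.
Hypothesis K_gt0 : 0 < K.
Hypothesis lambda_gt0 : 0 < lambda.
Hypothesis z_gt0 : 0 < z.

Local Notation g := (ell^`()%classic).
Local Notation J := (clipped_inverse ell).

(** The density of the worst-case measure, once [z] is chosen so that it has
    mass one. The positive part of [phi] makes it nonnegative also on the null
    set where [phi] is negative. *)
Definition worst_density (w : T) : R :=
  Num.min (Num.max (phi w) 0) z / (lambda * z).

(** The pointwise minimizer of [ell (x - m) - gamma * Num.max (phi w) z * x]
    over [0 <= x <= K], that is [m + I (gamma * Num.max (phi w) z)] cut off at [0]
    and [K]. *)
Definition claim (gamma m : R) (w : T) : R :=
  m + J (- m) (K - m) (gamma * Num.max (phi w) z).

Local Notation D := worst_density.
Local Notation X := claim.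

Lemma worst_density_bounds w : 0 <= D w <= lambda^-1.
Proof.
have lz : 0 < lambda * z by rewrite mulr_gt0.
rewrite /D; apply/andP; split.
  by rewrite divr_ge0// ?(ltW lz)// le_min le_max lexx orbT ltW.
by rewrite ler_pdivrMr// mulKf ?gt_eqF// ge_min lexx orbT.
Qed.

Lemma worst_density_gt0 w : 0 < phi w -> 0 < D w.
Proof. by move=> p0; rewrite /D divr_gt0 ?mulr_gt0// lt_min lt_max p0. Qed.

Lemma worst_density_high w : z <= phi w -> D w = lambda^-1.
Proof.
move=> zp; rewrite /D min_r ?le_max ?zp//.
by rewrite invfM mulrC -mulrA mulVf ?mulr1// gt_eqF.
Qed.

(** The price density factors through the worst-case density. So pricing by
    [phi] and measuring loss by [worst_density] leave a pointwise problem with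
    the marginal price [Num.max (phi w) z]. *)
Lemma worst_densityE w : 0 <= phi w ->
  phi w = lambda * D w * Num.max (phi w) z.
Proof.
move=> p0; rewrite /D (max_idPl p0); have [zp|pz] := leP z (phi w).
  by field; rewrite !gt_eqF.
by field; rewrite !gt_eqF.
Qed.

Lemma measurable_worst_density : measurable_fun [set: T] D.
Proof.
apply: measurable_funM => //; apply: measurable_minr => //.
exact: measurable_maxr.
Qed.

Let lohi (m : R) : - m <= K - m. Proof. by rewrite lerDr ltW. Qed.

Lemma claim_sub gamma m w :
  X gamma m w - m = J (- m) (K - m) (gamma * Num.max (phi w) z).
Proof. by rewrite /X addrC addKr. Qed.

Lemma claim_bounds gamma m w : 0 <= X gamma m w <= K.
Proof.
have := clipped_ge Hl (gamma * Num.max (phi w) z) (lohi m).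
have := clipped_le Hl (gamma * Num.max (phi w) z) (lohi m).
by rewrite /X; lra.
Qed.

Lemma measurable_claim gamma m : measurable_fun [set: T] (X gamma m).
Proof.
apply: measurable_funD => //.
have mJ : measurable_fun [set: R] (J (- m) (K - m)).
  apply: continuous_measurable_fun => y.
  by apply: (clipped_cvg Hl) => //; exact: cvg_cst.
apply: (measurableT_comp mJ); apply: measurable_funM => //.
exact: measurable_maxr.
Qed.

(** A larger multiplier buys more, and the cut-off levels [0] and [K] of the
    claim do not depend on [m]. *)
Lemma claim_homo gamma gamma' m m' w : gamma <= gamma' -> m <= m' ->
  X gamma m w <= X gamma' m' w.
Proof.
move=> gg mm; have mm0 : 0 <= m' - m by rewrite subr_ge0.
apply: (@le_trans _ _ (X gamma m' w)).
  rewrite /X; have := clipped_shift Hl (gamma * Num.max (phi w) z) (lohi m) mm0.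
  have -> : - m - (m' - m) = - m' by ring.
  have -> : K - m - (m' - m) = K - m' by ring.
  by lra.
rewrite /X lerD2l (clipped_homo Hl)//.
by rewrite ler_wpM2r// le_max (ltW z_gt0) orbT.
Qed.

Lemma claim_loss_homo gamma gamma' m m' w : gamma <= gamma' -> m' <= m ->
  ell (X gamma m w - m) <= ell (X gamma' m' w - m').
Proof.
move=> gg mm; rewrite !claim_sub (loss_mono Hl).
apply: (clipped_homo Hl) => //; try lra.
by rewrite ler_wpM2r// le_max (ltW z_gt0) orbT.
Qed.

(** The tangent line of [ell] at [claim gamma m w - m], with the first-order
    optimality of the claim replacing [ell'] by the marginal price. *)
Lemma claim_optimal_lt gamma m w y : 0 < phi w -> 0 <= y <= K ->
  y != X gamma m w ->
  gamma / lambda * (phi w * (y - X gamma m w))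
    < D w * (ell (y - m) - ell (X gamma m w - m)).
Proof.
move=> p0 y0K yX; have D0 := worst_density_gt0 p0.
rewrite {1}(worst_densityE (ltW p0)).
set M := Num.max _ _.
have -> : gamma / lambda * (lambda * D w * M * (y - X gamma m w)) =
    D w * (gamma * M * (y - X gamma m w)).
  by field; rewrite gt_eqF.
rewrite ltr_pM2l//.
have Jy : - m <= y - m <= K - m by rewrite lerBrDr addNr lerD2r.
have := clipped_projection Hl (gamma * M) Jy.
have yJ : X gamma m w - m != y - m by rewrite (inj_eq (addIr _)) eq_sym.
have := loss_tangent_lt Hl yJ.
by rewrite claim_sub -/M /X -/M; lra.
Qed.

Lemma claim_optimal gamma m w y : 0 < phi w -> 0 <= y <= K ->
  gamma / lambda * (phi w * (y - X gamma m w))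
    <= D w * (ell (y - m) - ell (X gamma m w - m)).
Proof.
move=> p0 y0K; have [->|yX] := eqVneq y (X gamma m w).
  by rewrite !subrr !mulr0.
by rewrite ltW// claim_optimal_lt.
Qed.

Hypothesis phi_int : P.-integrable [set: T] (EFin \o phi).
Hypothesis phi_gt0 : {ae P, forall w, 0 < phi w}.
(** Unboundedness of [phi], as the existence of a point above [t] in every event
    of full measure: the form in which almost sure equalities are refuted. *)
Hypothesis phi_tail : forall (t : R) (A : T -> Prop),
  {ae P, forall w, A w} -> exists2 w, t < phi w & A w.
Hypothesis D_mass : \int[P]_w D w = 1.
Hypothesis phi_mass : \int[P]_w phi w = 1.

Lemma worst_density_integrable f C : measurable_fun [set: T] f ->
  (forall w, `|f w| <= C) ->
  P.-integrable [set: T] (EFin \o (fun w => D w * f w)).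
Proof.
move=> mf fC; apply: (@bounded_integrable _ _ _ _ _ (lambda^-1 * C)).
  by apply: measurable_funM => //; exact: measurable_worst_density.
move=> w; have /andP[D0 D1] := worst_density_bounds w.
by rewrite normrM ler_pM// ger0_norm.
Qed.

Lemma price_integrable f C : measurable_fun [set: T] f ->
  (forall w, `|f w| <= C) ->
  P.-integrable [set: T] (EFin \o (fun w => phi w * f w)).
Proof.
move=> mf fC.
apply: (@le_integrable _ _ _ P _ measurableT _ (EFin \o (fun w => C * phi w))).
- by apply/measurable_EFinP; exact: measurable_funM.
- move=> w _ /=; rewrite lee_fin !normrM mulrC ler_wpM2r//.
  exact: le_trans (fC w) (ler_norm _).
- exact: integrable_scale.
Qed.

(** The expected loss under the worst-case measure when the capital [m] is held
    against the claim. *)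
Definition risk gamma m := \int[P]_w (D w * ell (X gamma m w - m)).

Lemma measurable_loss f m : measurable_fun [set: T] f ->
  measurable_fun [set: T] (fun w => ell (f w - m)).
Proof.
move=> mf; apply: (@measurableT_comp _ _ _ _ _ _ ell).
  by apply: continuous_measurable_fun; exact: loss_continuous Hl.
exact: measurable_funB.
Qed.

Lemma loss_bounds x m : 0 <= x <= K ->
  `|ell (x - m)| <= `|ell (- m)| + `|ell (K - m)|.
Proof. by move=> xK; apply: (loss_bound Hl); rewrite lerBrDr addNr lerD2r. Qed.

Lemma loss_integrable f m : measurable_fun [set: T] f ->
  (forall w, 0 <= f w <= K) ->
  P.-integrable [set: T] (EFin \o (fun w => D w * ell (f w - m))).
Proof.
move=> mf fK.
apply: (@worst_density_integrable _ (`|ell (- m)| + `|ell (K - m)|)).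
  exact: measurable_loss.
by move=> w; exact: loss_bounds.
Qed.

Lemma claim_cvg {U : Type} (F : set_system U) {FF : Filter F}
    (gamma_ m_ : U -> R) gamma m w : gamma_ @ F --> gamma -> m_ @ F --> m ->
  (fun u => X (gamma_ u) (m_ u) w) @ F --> X gamma m w.
Proof.
move=> cg cm; apply: cvgD => //; apply: (clipped_cvg Hl) => //.
- exact: cvgN.
- by apply: cvgB => //; exact: cvg_cst.
- by apply: cvgM => //; exact: cvg_cst.
Qed.

Lemma claim_loss_cvg {U : Type} (F : set_system U) {FF : Filter F}
    (gamma_ m_ : U -> R) gamma m w : gamma_ @ F --> gamma -> m_ @ F --> m ->
  (fun u => D w * ell (X (gamma_ u) (m_ u) w - m_ u)) @ F
    --> D w * ell (X gamma m w - m).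
Proof.
move=> cg cm; apply: cvgM; first exact: cvg_cst.
apply: continuous_cvg; first exact: loss_continuous Hl _.
by apply: cvgB => //; exact: claim_cvg.
Qed.

Lemma risk_continuous_l m : continuous (risk ^~ m).
Proof.
apply: (@continuous_Rintegral _ _ _ _ _
   (fun _ _ => lambda^-1 * (`|ell (- m)| + `|ell (K - m)|))).
- move=> t; apply: measurable_funM; first exact: measurable_worst_density.
  by apply: measurable_loss; exact: measurable_claim.
- move=> w t; by apply: claim_loss_cvg; (exact: cvg_id || exact: cvg_cst).
- by move=> c; exact: finite_measure_integrable_cst.
- move=> c t w _ _; have /andP[D0 D1] := worst_density_bounds w.
  rewrite normrM ler_pM// ?(ger0_norm D0)//.
  by apply: loss_bounds; exact: claim_bounds.
Qed.

Lemma risk_continuous_r gamma : continuous (risk gamma).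
Proof.
apply: (@continuous_Rintegral _ _ _ _ _
   (fun c _ => lambda^-1 * (`|ell (- c - 1)| + `|ell (K - c + 1)|))).
- move=> t; apply: measurable_funM; first exact: measurable_worst_density.
  by apply: measurable_loss; exact: measurable_claim.
- move=> w t; by apply: claim_loss_cvg; (exact: cvg_id || exact: cvg_cst).
- by move=> c; exact: finite_measure_integrable_cst.
- move=> c t w ct tc; have /andP[D0 D1] := worst_density_bounds w.
  rewrite normrM ler_pM// ?(ger0_norm D0)//.
  apply: (loss_bound Hl); have := claim_bounds gamma t w; lra.
Qed.

Lemma risk_homo gamma gamma' m : gamma <= gamma' ->
  risk gamma m <= risk gamma' m.
Proof.
move=> gg; apply: le_Rintegral => //.
- by apply: loss_integrable; [exact: measurable_claim|exact: claim_bounds].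
- by apply: loss_integrable; [exact: measurable_claim|exact: claim_bounds].
move=> w _; have /andP[D0 _] := worst_density_bounds w.
by rewrite ler_wpM2l// claim_loss_homo.
Qed.

Lemma claim_loss_integrable gamma m :
  P.-integrable [set: T] (EFin \o (fun w => D w * ell (X gamma m w - m))).
Proof.
by apply: loss_integrable; [exact: measurable_claim|exact: claim_bounds].
Qed.

Lemma payoff_integrable f : measurable_fun [set: T] f ->
  (forall w, 0 <= f w <= K) ->
  P.-integrable [set: T] (EFin \o (fun w => phi w * f w)).
Proof.
move=> mf fK; apply: (@price_integrable _ K) => // w.
by have /andP[f0 fk] := fK w; rewrite ger0_norm.
Qed.

(** Adding capital lowers the loss strictly wherever the claim equals [K]. For
    [gamma > 0] this happens with positive probability because [phi] is
    unbounded; for [gamma <= 0] the claim is zero. *)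
Lemma risk_decreasing gamma m m' : m < m' -> risk gamma m' < risk gamma m.
Proof.
move=> mm; rewrite ltNge; apply/negP => rr.
pose h w := D w * ell (X gamma m w - m) - D w * ell (X gamma m' w - m').
have h0 w : 0 <= h w.
  have /andP[D0 _] := worst_density_bounds w.
  by rewrite subr_ge0 ler_wpM2l// claim_loss_homo// ltW.
have hi : P.-integrable [set: T] (EFin \o h).
  by apply: integrable_sub; exact: claim_loss_integrable.
have : {ae P, forall w, h w = 0}.
  apply: ae_ge0_Rintegral_eq0 => //; first exact: aeW.
  rewrite RintegralB ?subr_le0//; exact: claim_loss_integrable.
move=> /(filterI phi_gt0) /(phi_tail (g (K - m) / gamma))[w wt /= [w0]].
apply/eqP; rewrite gt_eqF// subr_gt0 ltr_pM2l ?worst_density_gt0//.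
rewrite (leW_mono (loss_mono Hl)) !claim_sub.
have [g0|g0] := leP gamma 0.
  have low n : gamma * Num.max (phi w) z <= g (- n).
    by rewrite (le_trans _ (ltW (dloss_gt0 Hl _)))// mulr_le0_ge0// le_max ltW.
  by rewrite !(clipped_low Hl)// ltrN2.
rewrite [ltRHS](clipped_high Hl)//; last first.
  by rewrite mulrC -ler_pdivrMr// le_max (ltW wt).
by rewrite (le_lt_trans (clipped_le Hl _ _))// ltrD2l ltrN2.
Qed.

Lemma worst_mean_cst (c : R) : \int[P]_w (D w * c) = c.
Proof.
rewrite RintegralZr ?D_mass ?mul1r//.
apply: (@bounded_integrable _ _ _ _ _ lambda^-1) => [|w].
  exact: measurable_worst_density.
by have /andP[D0 D1] := worst_density_bounds w; rewrite ger0_norm.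
Qed.

Lemma worst_mean_ge f c :
  P.-integrable [set: T] (EFin \o (fun w => D w * f w)) ->
  (forall w, c <= f w) -> c <= \int[P]_w (D w * f w).
Proof.
move=> fi cf; rewrite -[leLHS]worst_mean_cst; apply: le_Rintegral => //.
  by apply: (@worst_density_integrable _ `|c|).
by move=> w _; have /andP[D0 _] := worst_density_bounds w; rewrite ler_wpM2l.
Qed.

Lemma worst_mean_le f c :
  P.-integrable [set: T] (EFin \o (fun w => D w * f w)) ->
  (forall w, f w <= c) -> \int[P]_w (D w * f w) <= c.
Proof.
move=> fi cf; rewrite -[leRHS]worst_mean_cst; apply: le_Rintegral => //.
  by apply: (@worst_density_integrable _ `|c|).
by move=> w _; have /andP[D0 _] := worst_density_bounds w; rewrite ler_wpM2l.
Qed.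

Definition revenue gamma m := \int[P]_w (phi w * X gamma m w).

(** For each [gamma], the loss at [m = - y0] is at least [ell y0] and the loss
    at [m = K - y0] at most [ell y0], since the claim lies between [0] and [K]. *)
Lemma capital_path (y0 : R) : exists m_ : R -> R, [/\
  forall gamma, risk gamma (m_ gamma) = ell y0,
  forall gamma, - y0 <= m_ gamma <= K - y0,
  {homo m_ : gamma gamma' / gamma <= gamma'} &
  continuous (fun gamma => revenue gamma (m_ gamma))].
Proof.
have /choice[m_ m_P] : forall gamma,
    exists m, risk gamma m = ell y0 /\ - y0 <= m <= K - y0.
  move=> gamma; have y0K : - y0 <= K - y0 by [].
  have lo : risk gamma (K - y0) <= ell y0.
    apply: worst_mean_le; first exact: claim_loss_integrable.
    move=> w; rewrite (loss_mono Hl).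
    have := claim_bounds gamma (K - y0) w; lra.
  have hi : ell y0 <= risk gamma (- y0).
    apply: worst_mean_ge; first exact: claim_loss_integrable.
    move=> w; rewrite (loss_mono Hl).
    have := claim_bounds gamma (- y0) w; lra.
  have [] := @IVT _ (risk gamma) _ _ (ell y0) y0K.
  - exact/continuous_subspaceT/risk_continuous_r.
  - by rewrite ge_min lo orbT le_max hi.
  - by move=> m; rewrite in_itv/= => mK rm; exists m.
have m_r gamma : risk gamma (m_ gamma) = ell y0 by case: (m_P gamma).
have m_c : continuous m_.
  exact: (implicit_function_continuous risk_continuous_l risk_decreasing m_r).
exists m_; split=> // [gamma|gamma gamma' gg|].
- by case: (m_P gamma).
- rewrite leNgt; apply/negP => /(risk_decreasing gamma').
  by rewrite m_r -(m_r gamma) ltNge risk_homo.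
- apply: (@continuous_Rintegral _ _ _ _ _ (fun _ w => K * `|phi w|)).
  + by move=> t; apply: measurable_funM => //; exact: measurable_claim.
  + move=> w t; apply: cvgM; first exact: cvg_cst.
    by apply: claim_cvg; [exact: cvg_id|exact: m_c].
  + by move=> c; apply: integrable_scale; exact: integrable_abse phi_int.
  + move=> c t w _ _; rewrite normrM mulrC ler_wpM2r//.
    by have /andP[X0 XK] := claim_bounds t (m_ t) w; rewrite ger0_norm.
Qed.

Lemma price_mean_cst (c : R) : \int[P]_w (phi w * c) = c.
Proof. by rewrite RintegralZr ?phi_mass ?mul1r. Qed.

(** Allowing [gamma <= 0], where the claim vanishes, provides the left endpoint
    for the intermediate value theorem; at the right endpoint the claim is
    constantly [K] because [m_] is bounded. *)
Lemma revenue_onto (y0 v : R) (m_ : R -> R) : 0 < v -> v < K ->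
  (forall gamma, - y0 <= m_ gamma <= K - y0) ->
  continuous (fun gamma => revenue gamma (m_ gamma)) ->
  exists2 gamma, 0 < gamma & revenue gamma (m_ gamma) = v.
Proof.
move=> v0 vK m_b rc.
have rneg gamma : gamma <= 0 -> revenue gamma (m_ gamma) = 0.
  move=> g0; rewrite /revenue -[RHS](price_mean_cst 0).
  apply: eq_Rintegral => w _; rewrite /X (clipped_low Hl) ?subrr//.
  rewrite (le_trans _ (ltW (dloss_gt0 Hl _)))// mulr_le0_ge0//.
  by rewrite le_max (ltW z_gt0) orbT.
pose G := g (K + y0) / z; have G0 : 0 <= G.
  by rewrite divr_ge0// ltW// (dloss_gt0 Hl).
have rG : revenue G (m_ G) = K.
  rewrite /revenue -[RHS]price_mean_cst.
  apply: eq_Rintegral => w _; rewrite /X (clipped_high Hl) ?subrKC//.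
  rewrite (@le_trans _ _ (G * z))//; last first.
    by rewrite ler_wpM2l// le_max lexx orbT.
  rewrite divfK ?gt_eqF// (dloss_mono Hl) lerD2l lerNl.
  by have /andP[] := m_b G.
have [] := @IVT _ (fun t => revenue t (m_ t)) _ _ v G0.
- exact/continuous_subspaceT.
- by rewrite rneg// rG ge_min (ltW v0) le_max (ltW vK) orbT.
move=> t _ rt; exists t => //; rewrite ltNge; apply/negP => t0.
by move: v0; rewrite -rt rneg// ltxx.
Qed.

(** The integrated form of [claim_optimal]: the slack [h] of the Lagrangian
    inequality. By [claim_optimal_lt] it almost surely vanishes only where [f]
    is the claim. *)
Lemma saddle_slack f gamma m : measurable_fun [set: T] f ->
  (forall w, 0 <= f w <= K) ->
  let h w := D w * (ell (f w - m) - ell (X gamma m w - m)) -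
             gamma / lambda * (phi w * (f w - X gamma m w)) in
  [/\ P.-integrable [set: T] (EFin \o h), {ae P, forall w, 0 <= h w} &
    \int[P]_w h w = \int[P]_w (D w * ell (f w - m)) - risk gamma m -
      gamma / lambda * (\int[P]_w (phi w * f w) - revenue gamma m)].
Proof.
move=> mf fK h.
have i1 : P.-integrable [set: T]
    (EFin \o (fun w => D w * ell (f w - m) - D w * ell (X gamma m w - m))).
  apply: integrable_sub; first exact: loss_integrable.
  exact: claim_loss_integrable.
have i2 : P.-integrable [set: T]
    (EFin \o (fun w => phi w * f w - phi w * X gamma m w)).
  apply: integrable_sub; apply: payoff_integrable => //.
    exact: measurable_claim.
  exact: claim_bounds.
have hE : h = fun w => (D w * ell (f w - m) - D w * ell (X gamma m w - m)) -
   gamma / lambda * (phi w * f w - phi w * X gamma m w).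
  by apply/funext => w; rewrite /h !mulrBr.
split.
- by rewrite hE; apply: integrable_sub => //; exact: integrable_scale.
- by apply: filterS phi_gt0 => w w0; rewrite subr_ge0 claim_optimal.
- rewrite hE RintegralB//; last exact: integrable_scale.
  rewrite RintegralB//; [|exact: loss_integrable|exact: claim_loss_integrable].
  rewrite RintegralZl// RintegralB//; first exact: payoff_integrable.
  by apply: payoff_integrable; [exact: measurable_claim|exact: claim_bounds].
Qed.

Lemma saddle_le f gamma m : measurable_fun [set: T] f ->
  (forall w, 0 <= f w <= K) -> 0 <= gamma ->
  revenue gamma m <= \int[P]_w (phi w * f w) ->
  risk gamma m <= \int[P]_w (D w * ell (f w - m)).
Proof.
move=> mf fK g0 rev; have [hi h0 hE] := saddle_slack gamma m mf fK.
have := ae_ge0_Rintegral hi h0; rewrite hE.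
have : 0 <= gamma / lambda * (\int[P]_w (phi w * f w) - revenue gamma m).
  by rewrite mulr_ge0 ?subr_ge0// divr_ge0// ltW.
lra.
Qed.

Lemma saddle_unique f gamma m : measurable_fun [set: T] f ->
  (forall w, 0 <= f w <= K) -> 0 <= gamma ->
  revenue gamma m <= \int[P]_w (phi w * f w) ->
  \int[P]_w (D w * ell (f w - m)) <= risk gamma m ->
  {ae P, forall w, f w = X gamma m w}.
Proof.
move=> mf fK g0 rev rsk; have [hi h0 hE] := saddle_slack gamma m mf fK.
have : {ae P, forall w, D w * (ell (f w - m) - ell (X gamma m w - m)) -
             gamma / lambda * (phi w * (f w - X gamma m w)) = 0}.
  apply: ae_ge0_Rintegral_eq0 => //; rewrite hE.
  have : 0 <= gamma / lambda * (\int[P]_w (phi w * f w) - revenue gamma m).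
    by rewrite mulr_ge0 ?subr_ge0// divr_ge0// ltW.
  lra.
apply: filterS2 phi_gt0 => w w0 hw; apply/eqP/negPn/negP => fX.
by have := claim_optimal_lt w0 (fK w) fX; rewrite -subr_gt0 hw ltxx.
Qed.

(** * The form of the optimal claims *)

Local Notation z_ gamma m := (Num.max z (g (- m) / gamma)).

(** The value of the claim on [phi <= z]: the constant [alpha] of the theorem. *)
Definition floor_value gamma m := m + J (- m) (K - m) (gamma * z).

Lemma threshold_scale gamma m : 0 < gamma ->
  gamma * z_ gamma m = Num.max (gamma * z) (g (- m)).
Proof. by move=> g0; rewrite maxr_pMr ?ltW// mulrCA divff ?mulr1// gt_eqF. Qed.

(** Otherwise the claim would be constantly [K] and its price would be [K]. *)
Lemma claim_unsaturated gamma m : 0 < gamma -> revenue gamma m < K ->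
  gamma * z < g (K - m).
Proof.
move=> g0; apply: contraTlt => gK.
rewrite -leNgt /revenue -[leLHS]price_mean_cst.
rewrite le_eqVlt; apply/orP; left; apply/eqP; apply: eq_Rintegral => w _.
rewrite /X (clipped_high Hl) ?subrKC// (le_trans gK)// ler_pM2l//.
by rewrite le_max lexx orbT.
Qed.

Lemma dloss_floor gamma m : 0 < gamma -> gamma * z < g (K - m) ->
  g (floor_value gamma m - m) = gamma * z_ gamma m.
Proof.
move=> g0 gK; rewrite threshold_scale// /floor_value addrC addKr.
rewrite (dloss_clipped Hl)// min_l// ge_max (ltW gK)/= (dloss_mono Hl).
exact: lohi.
Qed.

Lemma claim_form gamma m w : 0 < gamma -> gamma * z < g (K - m) ->
  let alpha := floor_value gamma m in
  let I := ext_inverse ell a b in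
  (X gamma m w)%:E = (alpha%:E +
    Order.min (I (gamma * Num.max (phi w) (z_ gamma m))%R -
               I (gamma * z_ gamma m)%R) (K - alpha)%R%:E)%E.
Proof.
move=> g0 gK alpha I.
have gin x : I (g x) = x%:E.
  have [ax xb] := dloss_range Hl x.
  by rewrite /I /ext_inverse leNgt xb/= leNgt ax/= (dlossK Hl).
rewrite -dloss_floor// -/alpha gin.
set y := gamma * Num.max (phi w) (z_ gamma m).
have yE : y = Num.max (gamma * Num.max (phi w) z) (g (- m)).
  by rewrite /y maxA maxr_pMr ?ltW// mulrCA divff ?mulr1// gt_eqF.
have XE : X gamma m w = m + pinv setT g (Num.min y (g (K - m))) by rewrite yE.
have ya : a < y.
  by rewrite yE lt_max; have [-> _] := dloss_range Hl (- m); rewrite orbT.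
have [_ Kb] := dloss_range Hl (K - m).
(* Beyond b the inverse is infinite and the minimum selects K. *)
have [by_|yb] := leP b y%:E.
  have -> : I y = +oo%E by rewrite /I /ext_inverse by_.
  rewrite XE min_r; last by rewrite -lee_fin ltW// (lt_le_trans Kb).
  by rewrite (dlossK Hl) addye// min_r ?leey// -EFinD !subrKC.
have yI := inv_dlossK Hl ya yb.
have -> : I y = (pinv setT g y)%:E.
  by rewrite /I /ext_inverse leNgt yb/= leNgt ya.
rewrite XE -EFinB -EFin_min -EFinD; congr EFin.
set t := pinv setT g y in yI *.
have -> : pinv setT g (Num.min y (g (K - m))) = Num.min t (K - m).
  rewrite -yI; case: (leP t (K - m)) => h.
    by rewrite min_l ?(dloss_mono Hl)// (dlossK Hl).
  by rewrite min_r ?(dloss_mono Hl) ?ltW// (dlossK Hl).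
by rewrite !addr_minr; congr Num.min; ring.
Qed.

Lemma floor_value_ge0 gamma m : 0 <= floor_value gamma m.
Proof.
by have := clipped_ge Hl (gamma * z) (lohi m); rewrite /floor_value; lra.
Qed.

Lemma claim_ge_floor gamma m w : 0 <= gamma ->
  floor_value gamma m <= X gamma m w.
Proof.
move=> g0; rewrite lerD2l (clipped_homo Hl)//.
by rewrite ler_wpM2l// le_max lexx orbT.
Qed.

Lemma claim_low gamma m w : phi w <= z -> X gamma m w = floor_value gamma m.
Proof. by move=> pz; rewrite /X max_r. Qed.

(** Positivity of [f] with positive probability is stated as the existence of
    a point of positivity in every event of full measure. *)
Lemma price_mean_gt0 f C : measurable_fun [set: T] f ->
  (forall w, 0 <= f w <= C) ->
  (forall A : T -> Prop, {ae P, forall w, A w} -> exists2 w, 0 < f w & A w) ->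
  0 < \int[P]_w (phi w * f w).
Proof.
move=> mf f0 fA; rewrite ltNge; apply/negP => I0.
have /fA[w fw /=] : {ae P, forall w, 0 < phi w /\ phi w * f w = 0}.
  apply: filterI => //; apply: ae_ge0_Rintegral_eq0 => //.
    apply: (@price_integrable _ C) => // w.
    by have /andP[h1 h2] := f0 w; rewrite ger0_norm.
  apply: filterS phi_gt0 => w /ltW w0; apply: mulr_ge0 => //.
  by have /andP[] := f0 w.
by move=> [w0] /eqP; rewrite gt_eqF// mulr_gt0.
Qed.

(** The claim exceeds its floor where [phi] is above the threshold. *)
Lemma floor_lt_revenue gamma m : 0 < gamma -> gamma * z < g (K - m) ->
  floor_value gamma m < revenue gamma m.
Proof.
move=> g0 gK; rewrite -[ltLHS]price_mean_cst -subr_gt0 /revenue.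
rewrite -RintegralB//; first last.
- by apply: (@price_integrable _ `|floor_value gamma m|).
- by apply: payoff_integrable; [exact: measurable_claim|exact: claim_bounds].
under eq_Rintegral do rewrite -mulrBr.
apply: (@price_mean_gt0 _ K).
- by apply: measurable_funB => //; exact: measurable_claim.
- move=> w; rewrite subr_ge0 (claim_ge_floor _ _ (ltW g0))/=.
  have /andP[_] := claim_bounds gamma m w; have := floor_value_ge0 gamma m; lra.
- move=> A /(phi_tail (z_ gamma m))[w wz Aw]; exists w => //.
  have lK : J (- m) (K - m) (gamma * z) < K - m.
    by rewrite (clipped_lt Hl)// gK ltrDr K_gt0.
  rewrite subr_gt0 /floor_value ltrD2l (clipped_gt Hl)// lK andbT.
  apply/orP; left; have := dloss_floor g0 gK.
  rewrite /floor_value addrC addKr => ->; rewrite ltr_pM2l//.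
  by rewrite lt_max wz.
Qed.

Lemma floor_value_eq0 gamma m : gamma * z <= g (- m) -> floor_value gamma m = 0.
Proof. by move=> gm; rewrite /floor_value (clipped_low Hl)// subrr. Qed.

Lemma revenue_gt0 gamma m : 0 < gamma -> 0 < revenue gamma m.
Proof.
move=> g0; apply: (@price_mean_gt0 _ K).
- exact: measurable_claim.
- exact: claim_bounds.
- move=> A /(phi_tail (g (K - m) / gamma))[w wt Aw]; exists w => //.
  rewrite /X (clipped_high Hl) ?subrKC//.
  by rewrite mulrC -ler_pdivrMr// le_max (ltW wt).
Qed.

(** The event [phi <= z] has positive probability, in the same form. *)
Hypothesis phi_low : forall A : T -> Prop,
  {ae P, forall w, A w} -> exists2 w, phi w <= z & A w.

Lemma revenue_ltK gamma m : gamma * z <= g (- m) -> revenue gamma m < K.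
Proof.
move=> gm; rewrite -[ltRHS]price_mean_cst -subr_gt0 /revenue.
rewrite -RintegralB//; first last.
- by apply: payoff_integrable; [exact: measurable_claim|exact: claim_bounds].
- by apply: (@price_integrable _ `|K|).
under eq_Rintegral do rewrite -mulrBr.
apply: (@price_mean_gt0 _ K).
- by apply: measurable_funB => //; exact: measurable_claim.
- by move=> w; have := claim_bounds gamma m w; lra.
- move=> A /phi_low[w wz Aw]; exists w => //.
  by rewrite claim_low// floor_value_eq0// subr0.
Qed.

(** Claims increase along the path, so a price that is not larger forces the
    two claims to agree almost surely, in particular on [phi <= z], where the
    smaller one is zero. *)
Lemma floor_value_mono0 gamma m gamma0 m0 : gamma0 <= gamma -> m0 <= m ->
  gamma0 * z <= g (- m0) -> revenue gamma m <= revenue gamma0 m0 ->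
  floor_value gamma m = 0.
Proof.
move=> gg mm gm rr; apply/eqP/negPn/negP => fn0.
move: rr; apply/negP; rewrite -ltNge.
have XX w : X gamma0 m0 w <= X gamma m w by exact: claim_homo.
rewrite -subr_gt0 /revenue -RintegralB//; first last.
- by apply: payoff_integrable; [exact: measurable_claim|exact: claim_bounds].
- by apply: payoff_integrable; [exact: measurable_claim|exact: claim_bounds].
under eq_Rintegral do rewrite -mulrBr.
apply: (@price_mean_gt0 _ K).
- by apply: measurable_funB; exact: measurable_claim.
- move=> w; have := claim_bounds gamma m w; have := claim_bounds gamma0 m0 w.
  by have := XX w; lra.
- move=> A /phi_low[w wz Aw]; exists w => //.
  rewrite !claim_low// (floor_value_eq0 gm) subr0.
  by rewrite lt_neqAle eq_sym fn0 floor_value_ge0.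
Qed.

(** * The risk measure of a claim *)

Section robust.
Variable y0 : R.
Local Notation x0 := (ell y0).
Local Notation rho Y := (rho_hat P ell x0 lambda (fun w => - Y w)).

(** The capital levels over which [rho_hat] takes its infimum, without the
    supremum over measures and the double negation. *)
Definition acceptable Y : set R := [set m : R |
  forall Q, Qset P lambda Q -> ('E_Q[fun w => (ell (Y w - m))%R] <= x0%:E)%E].

Lemma rho_hatE Y : rho Y = inf (acceptable Y).
Proof.
congr inf; apply/seteqP; split => m /= mP.
  move=> Q QP; apply: le_trans mP; apply: ereal_sup_ubound; exists Q => //.
  by under [in LHS]eq_fun do rewrite opprK.
apply: ub_ereal_sup => _ [Q QP <-].
under eq_fun do rewrite opprK.
exact: mP.
Qed.

(** Subtract from the loss its smallest value [c], attained on [phi <= z]. What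
    remains is nonnegative, so its mean under any measure of the class is at
    most [1 / lambda] times its integral; the worst-case density attains this
    bound since it equals [1 / lambda] wherever the remainder is nonzero. *)
Lemma acceptable_claim gamma m : 0 <= gamma -> risk gamma m = x0 ->
  acceptable (X gamma m) m.
Proof.
move=> g0 rm Q QP; set c := ell (J (- m) (K - m) (gamma * z)).
pose L w := ell (X gamma m w - m); pose f w := L w - c.
pose C : R := `|ell (- m)| + `|ell (K - m)|.
have mL : measurable_fun [set: T] L.
  by apply: measurable_loss; exact: measurable_claim.
have LC w : `|L w| <= C by apply: loss_bounds; exact: claim_bounds.
have LQ : Q.-integrable [set: T] (EFin \o L) := bounded_integrable _ mL LC.
have f0 w : 0 <= f w.
  rewrite subr_ge0 /L claim_sub (loss_mono Hl); apply: (clipped_homo Hl) => //.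
  by rewrite ler_wpM2l// le_max lexx orbT.
have fC w : 0 <= f w <= C - c.
  by rewrite f0 lerD2r (le_trans (ler_norm _)).
have mf : measurable_fun [set: T] f by exact: measurable_funB.
have fn w : `|f w| <= C - c by rewrite ger0_norm//; case/andP: (fC w).
have Df : \int[P]_w (D w * f w) = lambda^-1 * \int[P]_w f w.
  rewrite -RintegralZl//; last exact: (bounded_integrable _ mf fn).
  apply: eq_Rintegral => w _.
  have [zp|pz] := leP z (phi w); first by rewrite worst_density_high.
  by rewrite /f /L claim_sub max_r ?(ltW pz)// subrr !mulr0.
have := Qset_expectation_le lambda_gt0 QP mf fC.
have -> : 'E_Q[f]%E = (\int[Q]_w L w - c)%:E.
  rewrite unlock EFin_Rintegral; last exact: (bounded_integrable _ mf fn).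
  rewrite RintegralB//; last by apply: (@bounded_integrable _ _ _ Q _ `|c|).
  by rewrite Rintegral_cst// [X in fine X](probability_setT Q) mulr1.
rewrite unlock EFin_Rintegral// !lee_fin -Df.
have -> : \int[P]_w (D w * f w) = x0 - c.
  rewrite -rm -[X in _ - X]worst_mean_cst -RintegralB//.
  - by apply: eq_Rintegral => w _; rewrite mulrBr.
  - exact: claim_loss_integrable.
  - by apply: (@worst_density_integrable _ `|c|).
by rewrite lerD2r.
Qed.

Section claims.
Variable Y : T -> R.
Hypothesis mY : measurable_fun [set: T] Y.
Hypothesis YK : forall w, 0 <= Y w <= K.

Lemma acceptable_worst m : acceptable Y m ->
  \int[P]_w (D w * ell (Y w - m)) <= x0.
Proof.
move=> am.
have [Q QP QE] := density_probability lambda_gt0 measurable_worst_density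
  worst_density_bounds D_mass.
have := am Q QP; rewrite (QE _ (`|ell (- m)| + `|ell (K - m)|)) ?lee_fin//.
  exact: measurable_loss.
by move=> w; exact: loss_bounds.
Qed.

Lemma acceptable_lbound m : acceptable Y m -> - y0 <= m.
Proof.
move=> /acceptable_worst; apply: contraTle => my; rewrite -ltNge.
have : ell (- m) <= \int[P]_w (D w * ell (Y w - m)).
  apply: worst_mean_ge; first exact: loss_integrable.
  by move=> w; rewrite (loss_mono Hl); have := YK w; lra.
by apply: lt_le_trans; rewrite (leW_mono (loss_mono Hl)) ltrNr.
Qed.

Lemma acceptable_max : acceptable Y (K - y0).
Proof.
move=> Q QP; rewrite -(expectation_cst Q) unlock; apply: le_integral => //.
- apply: (@bounded_integrable _ _ _ Q _
      (`|ell (- (K - y0))| + `|ell (K - (K - y0))|)).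
    exact: measurable_loss.
  by move=> w; exact: loss_bounds.
- by apply: (@bounded_integrable _ _ _ Q _ `|x0|).
- by move=> w _; rewrite lee_fin (loss_mono Hl); have := YK w; lra.
Qed.

Lemma acceptable_has_inf : has_inf (acceptable Y).
Proof.
split; first by exists (K - y0); exact: acceptable_max.
by exists (- y0) => m; exact: acceptable_lbound.
Qed.

Lemma rho_hat_le m : acceptable Y m -> rho Y <= m.
Proof.
by move=> am; rewrite rho_hatE; apply: ge_inf => //; case: acceptable_has_inf.
Qed.

(** The tangent inequality of [ell] bounds the slope of the expected loss in [m]
    on both sides: the lower bound gives strict decrease, the upper bound lets
    the loss constraint pass to the infimum [rho_hat]. *)
Lemma worst_mean_slope m m' : m <= m' ->
  g (- m') * (m' - m) <=
    \int[P]_w (D w * ell (Y w - m)) - \int[P]_w (D w * ell (Y w - m'))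
    <= g (K - m) * (m' - m).
Proof.
move=> mm.
have E : \int[P]_w (D w * ell (Y w - m)) - \int[P]_w (D w * ell (Y w - m')) =
    \int[P]_w (D w * (ell (Y w - m) - ell (Y w - m'))).
  rewrite -RintegralB//; [|exact: loss_integrable|exact: loss_integrable].
  by apply: eq_Rintegral => w _; rewrite mulrBr.
have i : P.-integrable [set: T]
    (EFin \o (fun w => D w * (ell (Y w - m) - ell (Y w - m')))).
  have := integrable_sub (loss_integrable m mY YK) (loss_integrable m' mY YK).
  by congr integrable; apply/funext => w /=; rewrite mulrBr.
have mm0 : 0 <= m' - m by rewrite subr_ge0.
rewrite E; apply/andP; split.
  apply: worst_mean_ge => // w.
  have := loss_tangent_le Hl (Y w - m') (Y w - m).
  have : g (- m') * (m' - m) <= g (Y w - m') * (m' - m).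
    by rewrite ler_wpM2r// (dloss_mono Hl); have := YK w; lra.
  have -> : Y w - m - (Y w - m') = m' - m by ring.
  by lra.
apply: worst_mean_le => // w.
have := loss_tangent_le Hl (Y w - m) (Y w - m').
have : g (Y w - m) * (m' - m) <= g (K - m) * (m' - m).
  by rewrite ler_wpM2r// (dloss_mono Hl); have := YK w; lra.
have -> : Y w - m' - (Y w - m) = - (m' - m) by ring.
by rewrite mulrN; lra.
Qed.

Lemma rho_hat_worst : \int[P]_w (D w * ell (Y w - rho Y)) <= x0.
Proof.
apply/ler_addgt0Pr => e e0.
have C0 : 0 < g (K - rho Y) by exact: dloss_gt0 Hl _.
have := inf_adherent (divr_gt0 e0 C0) acceptable_has_inf.
rewrite -rho_hatE => -[m am]; rewrite -ltrBlDl ltr_pdivlMr// => mr.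
have /andP[_] := worst_mean_slope (rho_hat_le am).
by have := acceptable_worst am; lra.
Qed.

Lemma rho_hat_ge m : x0 <= \int[P]_w (D w * ell (Y w - m)) -> m <= rho Y.
Proof.
move=> xm; rewrite leNgt; apply/negP => rm.
have /andP[+ _] := worst_mean_slope (ltW rm).
have : 0 < g (- m) * (m - rho Y) by rewrite mulr_gt0 ?subr_gt0// (dloss_gt0 Hl).
by have := rho_hat_worst; lra.
Qed.

End claims.

Lemma claim_rho_hat gamma m : 0 <= gamma -> risk gamma m = x0 ->
  rho (X gamma m) = m.
Proof.
move=> g0 rm; apply/eqP; rewrite eq_le; apply/andP; split.
  apply: (@rho_hat_le (X gamma m)).
  - exact: measurable_claim.
  - exact: claim_bounds.
  - exact: acceptable_claim.
apply: (@rho_hat_ge (X gamma m)).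
- exact: measurable_claim.
- exact: claim_bounds.
- by rewrite -rm.
Qed.

Lemma admissibleP (v : R) (Y : {RV P >-> R}) : NP_admissible phi K v Y ->
  [/\ measurable_fun [set: T] Y, forall w, 0 <= Y w <= K &
      v <= \int[P]_w (phi w * Y w)].
Proof.
move=> [YK]; rewrite unlock EFin_Rintegral ?lee_fin//.
exact: payoff_integrable.
Qed.

Section optimum.
Variables (gamma m : R) (Xo : {RV P >-> R}).
Hypothesis gamma_ge0 : 0 <= gamma.
Hypothesis risk_x0 : risk gamma m = x0.
Hypothesis XoE : forall w, Xo w = X gamma m w.

Local Notation v := (revenue gamma m).

Lemma claim_admissible : NP_admissible phi K v Xo.
Proof.
split=> [w|]; first by rewrite XoE; exact: claim_bounds.
have -> : (fun w => phi w * Xo w) = (fun w => phi w * X gamma m w).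
  by apply/funext => w; rewrite XoE.
rewrite unlock EFin_Rintegral//.
by apply: payoff_integrable; [exact: measurable_claim|exact: claim_bounds].
Qed.

Lemma rho_hat_Xo : rho Xo = m.
Proof.
rewrite -[RHS](claim_rho_hat gamma_ge0 risk_x0).
by congr rho_hat; apply/funext => w; rewrite XoE.
Qed.

Lemma claim_minimal (Y : {RV P >-> R}) : NP_admissible phi K v Y -> m <= rho Y.
Proof.
move=> /admissibleP[mY YK vY]; apply: rho_hat_ge => //.
by rewrite -risk_x0; exact: saddle_le.
Qed.

Lemma claim_solution : NP_solution phi ell x0 lambda K v Xo.
Proof.
split; first exact: claim_admissible.
by move=> Y aY; rewrite rho_hat_Xo; exact: claim_minimal.
Qed.

Lemma claim_value : NP_value phi ell x0 lambda K v = m.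
Proof.
apply/eqP; rewrite eq_le; apply/andP; split.
  apply: ge_inf; last by exists Xo; [exact: claim_admissible|exact: rho_hat_Xo].
  by exists m => _ [Y aY <-]; exact: claim_minimal.
apply: lb_le_inf; last by move=> _ [Y aY <-]; exact: claim_minimal.
by exists m, Xo; [exact: claim_admissible|exact: rho_hat_Xo].
Qed.

Lemma claim_unique (Y : {RV P >-> R}) : NP_solution phi ell x0 lambda K v Y ->
  {ae P, forall w, Y w = X gamma m w}.
Proof.
move=> [aY /(_ _ claim_admissible)]; rewrite rho_hat_Xo => rY.
have [mY YK vY] := admissibleP aY.
have E : rho Y = m by apply/eqP; rewrite eq_le rY claim_minimal.
by apply: saddle_unique => //; rewrite risk_x0 -[in leLHS]E;
  exact: rho_hat_worst.
Qed.

End optimum.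
End robust.

End family.

(** * The price density *)

Section price_density.
Context (R : realType) (d : measure_display) (T : measurableType d).
Context (P : probability T R) (phi : {RV P >-> R}).

Lemma ess_sup_unbounded (t : R) (A : T -> Prop) :
  ess_sup P (fun w => (phi w)%:E) = +oo%E ->
  {ae P, forall w, A w} -> exists2 w, t < phi w & A w.
Proof.
move=> phi_sup Aae; apply: contrapT => no.
have /ess_supP : {ae P, forall w, ((phi w)%:E <= t%:E)%E}.
  apply: filterS Aae => w Aw; rewrite lee_fin leNgt; apply/negP => tw.
  by apply: no; exists w.
by rewrite phi_sup.
Qed.

Lemma cdf_gt0_meets (t : R) (A : T -> Prop) : (0 < cdf phi t)%E ->
  {ae P, forall w, A w} -> exists2 w, phi w <= t & A w.
Proof.
move=> phi_cdf [N [mN N0 AN]]; apply: contrapT => no.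
move: phi_cdf; rewrite ltNge -N0 => /negP; apply.
have -> : cdf phi t = P [set w | phi w <= t].
  by congr (P _); apply/seteqP; split => w /=; rewrite in_itv/=.
rewrite le_measure ?inE//.
  have -> : [set w | phi w <= t] = phi @^-1` `]-oo, t].
    by apply/seteqP; split => w /=; rewrite in_itv/=.
  exact: measurable_funPTI.
move=> w /= wt; apply: AN => /= Aw.
by apply: no; exists w.
Qed.

Hypothesis phi_gt0 : {ae P, forall w, 0 < phi w}.
Hypothesis phi_E1 : ('E_P[phi] = 1)%E.

Lemma price_density_integrable : P.-integrable [set: T] (EFin \o phi).
Proof.
have mphi : measurable_fun [set: T] (EFin \o phi) by exact/measurable_EFinP.
apply/integrableP; split => //.
rewrite (@ae_eq_integral _ _ _ P setT (EFin \o phi)) ?ltry//=.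
- by move: phi_E1; rewrite unlock => ->; rewrite ltry.
- by apply/measurable_EFinP; exact: measurableT_comp.
- by apply: filterS phi_gt0 => w w0 _ /=; rewrite ger0_norm ?ltW.
Qed.

Lemma price_density_mass : \int[P]_w phi w = 1.
Proof. by move: phi_E1; rewrite unlock /Rintegral => ->. Qed.

Let pcap t w := Num.min (Num.max (phi w) 0) t.

Let mpcap t : measurable_fun [set: T] (pcap t).
Proof. by apply: measurable_minr => //; exact: measurable_maxr. Qed.

Let pcap_bound t w : 0 <= t -> 0 <= pcap t w <= t.
Proof.
by move=> t0; rewrite /pcap le_min le_max lexx orbT t0 ge_min lexx orbT.
Qed.

Let pcap_integrable t : 0 <= t -> P.-integrable [set: T] (EFin \o pcap t).
Proof.
move=> t0; apply: (@bounded_integrable _ _ _ _ _ t) => // w.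
by have /andP[h1 h2] := pcap_bound w t0; rewrite ger0_norm.
Qed.

(** The capped density is [t] on [phi > t] (Markov's inequality). *)
Lemma capped_price_markov t : 0 < t ->
  t * (1 - fine (cdf phi t)) <= \int[P]_w pcap t w.
Proof.
move=> t0; pose A := phi @^-1` `]-oo, t].
have mA : measurable A by exact: measurable_funPTI.
have i1 : P.-integrable [set: T] (EFin \o (fun=> 1 : R)).
  by apply: (@bounded_integrable _ _ _ _ _ 1) => // w; rewrite normr1.
have i2 : P.-integrable [set: T] (EFin \o (\1_A : T -> R)).
  apply: (@bounded_integrable _ _ _ _ _ 1) => // w.
  by rewrite indicE; case: (_ \in _); rewrite ?normr1 ?normr0.
have iA : P.-integrable [set: T] (EFin \o (fun w => t * (1 - \1_A w))).
  by apply: integrable_scale; exact: integrable_sub.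
have <- : \int[P]_w (t * (1 - \1_A w)) = t * (1 - fine (cdf phi t)).
  rewrite RintegralZl//; last exact: integrable_sub.
  rewrite RintegralB// Rintegral_cst// [X in fine X](probability_setT P) mulr1.
  by rewrite /Rintegral integral_indic// setIT.
apply: le_Rintegral => //; first exact: pcap_integrable (ltW t0).
move=> w _; rewrite indicE; case: (boolP (w \in A)) => wA.
  by rewrite subrr mulr0; case/andP: (pcap_bound w (ltW t0)).
rewrite subr0 mulr1 /pcap le_min lexx andbT le_max.
move: wA; rewrite /A notin_setE/= in_itv/= => /negP.
by rewrite -ltNge => /ltW->.
Qed.

Lemma capped_price_continuous : continuous (fun t => \int[P]_w pcap t w).
Proof.
apply: (@continuous_Rintegral _ _ _ _ _ (fun c w => `|phi w| + (`|c| + 1))).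
- exact: mpcap.
- move=> w t.
  exact: (@continuous_min _ _ (fun=> Num.max (phi w) 0) id t (cvg_cst _)
            cvg_id).
- move=> c; apply: (@integrableD _ _ _ P setT measurableT
    (EFin \o (Num.norm \o phi)) (cst (`|c| + 1)%:E)).
    exact: integrable_abse price_density_integrable.
  exact: finite_measure_integrable_cst.
- move=> c t w ct tc; rewrite /pcap ler_norml.
  have := ler_norm (phi w); have := ler_norm c; have := lerNnormlW (lexx `|c|).
  have := normr_ge0 c; have := normr_ge0 (phi w).
  have [p0|p0] := leP (phi w) 0; case: (leP _ t) => _; lra.
Qed.

(** The function [W t = E[phi /\ t] - lambda t] is positive for some small [t],
    where [P (phi > t) > lambda], and nonpositive at [1 / lambda], since
    [E[phi] = 1]. At a zero [z], Markov's inequality gives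
    [P (phi > z) <= lambda], so that [z] is at least the quantile. *)
Lemma worst_density_level (lambda : R) : 0 < lambda -> lambda < 1 ->
  exists z : R, [/\ 0 < z, \int[P]_w worst_density phi lambda z w = 1 &
    0 < quantile phi (1 - lambda) <= z].
Proof.
move=> l0 l1; pose W t := \int[P]_w pcap t w - lambda * t.
have [t0 t00 ct0] : exists2 t0, 0 < t0 & (cdf phi t0 < (1 - lambda)%:E)%E.
  have c0 : cdf phi 0 = 0%E.
    apply/eqP; rewrite eq_le cdf_ge0 andbT leNgt; apply/negP => c0.
    by have [w] := cdf_gt0_meets c0 phi_gt0; rewrite leNgt => /negP.
  have : cdf phi t @[t --> 0^'+] --> cdf phi 0 by exact: cdf_right_continuous.
  rewrite c0 => /fine_cvg cr.
  near (0 : R)^'+ => t; exists t; first by near: t; exact: nbhs_right_gt.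
  rewrite -[cdf phi t]fineK ?fin_num_measure// lte_fin; near: t.
  by apply: (cvgr_lt _ cr); rewrite subr_gt0.
have cl t : cdf phi t = (fine (cdf phi t))%:E.
  by rewrite fineK// fin_num_measure.
have Wt0 : 0 < W t0.
  have := capped_price_markov t00; move: ct0; rewrite cl lte_fin /W; nra.
have capt t : 0 < t -> \int[P]_w pcap t w <= 1.
  move=> /ltW t0'.
  rewrite -price_density_mass -subr_ge0 -RintegralB//; last 2 first.
  - exact: price_density_integrable.
  - exact: pcap_integrable.
  apply: ae_ge0_Rintegral.
    exact: integrable_sub price_density_integrable (pcap_integrable _).
  apply: filterS phi_gt0 => w w0; rewrite subr_ge0 /pcap ge_min.
  by rewrite ge_max lexx ltW.
have Wl : W lambda^-1 <= 0.
  have := capt lambda^-1; rewrite invr_gt0 /W mulfV ?gt_eqF//.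
  by move=> /(_ l0); lra.
have tl : t0 <= lambda^-1.
  rewrite -[leRHS]mul1r ler_pdivlMr//; have := capt t0 t00.
  by move: Wt0; rewrite /W; lra.
have [] := @IVT _ W _ _ 0 tl.
- apply: continuous_subspaceT => t; apply: cvgB.
    exact: capped_price_continuous.
  by apply: cvgM; [exact: cvg_cst|exact: cvg_id].
- by rewrite ge_min Wl orbT le_max ltW.
move=> z; rewrite in_itv/= => /andP[tz _] /eqP; rewrite subr_eq0 => /eqP Wz.
have z0 : 0 < z by exact: lt_le_trans tz.
exists z; split => //.
  rewrite /worst_density RintegralZr//; last exact: pcap_integrable (ltW z0).
  by rewrite Wz divff// mulf_neq0// gt_eqF.
have lb : lbound [set x | ((1 - lambda)%:E <= cdf phi x)%E] t0.
  move=> x /= xl; rewrite leNgt; apply/negP => xt.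
  by have := cdf_nondecreasing phi (ltW xt); rewrite leNgt (lt_le_trans ct0).
have qz : ((1 - lambda)%:E <= cdf phi z)%E.
  by have := capped_price_markov z0; rewrite cl lee_fin Wz; nra.
apply/andP; split.
  by apply: (lt_le_trans t00); apply: lb_le_inf => //; exists z.
by apply: ge_inf => //; exists t0.
Unshelve. all: by end_near. Qed.

End price_density.

(** * Existence, uniqueness and form of the solution *)

(** On [phi <= z] the difference of the two inverse values is zero. So [alpha]
    is determined by the claim alone, whatever [z] and [gamma] are. *)
Lemma NP_form_low (R : realType) (d : measure_display) (T : measurableType d)
    (P : probability T R) (phi : {RV P >-> R}) (ell : R -> R) (a : R)
    (b : \bar R) (x0 lambda K v : R) (X : {RV P >-> R}) (alpha z gamma : R) :
  loss_function ell a b -> v < K -> 0 < z ->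
  NP_form phi ell a b x0 lambda K v X alpha z gamma ->
  {ae P, forall w, phi w <= z -> X w = alpha}.
Proof.
move=> Hl vK z0 [/andP[_ av] _ gammaE XE]; apply: filterS XE => w + wz.
set t := alpha - NP_value phi ell x0 lambda K v in gammaE.
have gz : gamma * z = ell^`()%classic t by rewrite gammaE divfK// gt_eqF.
have [ax xb] := dloss_range Hl t.
rewrite max_r// gz /ext_inverse leNgt xb/= leNgt ax/=.
rewrite subee// min_l ?adde0; first by move=> [].
by rewrite lee_fin subr_ge0 ltW// (lt_trans av).
Qed.

Theorem corollary3p5 (R : realType) (d : measure_display)
    (T : measurableType d) (P : probability T R) (K : R)
    (phi : {RV P >-> R}) (ell : R -> R) (a : R) (b : \bar R) (x0 lambda : R)
    (HP : atomless P)
    (HK : 0 < K)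
    (phi_unbounded : ess_sup P (fun w => (phi w)%:E) = +oo%E)
    (phi_gt0 : {ae P, forall w, 0 < phi w})
    (phi_E1 : ('E_P[phi] = 1)%E)
    (Hl : loss_function ell a b)
    (Hx0 : interior (range ell) x0)
    (cdf_cont : {within `]0, +oo[, continuous (cdf phi)})
    (cdf_incr : forall x y : R, 0 < x -> x < y -> (cdf phi x < cdf phi y)%E)
    (lambda_gt0 : 0 < lambda)
    (lambda_lt1 : lambda < 1) :
  (forall v : R, 0 < v -> v < K ->
    exists X : {RV P >-> R},
      [/\ NP_solution phi ell x0 lambda K v X,
          (forall Y : {RV P >-> R}, NP_solution phi ell x0 lambda K v Y ->
             {ae P, forall w, Y w = X w}) &
          exists alpha z gamma : R,
            NP_form phi ell a b x0 lambda K v X alpha z gamma]) /\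
  (exists vhat : R, [/\ 0 < vhat, vhat < K &
    forall v : R, 0 < v -> v <= vhat ->
      forall (X : {RV P >-> R}) (alpha z gamma : R),
        NP_solution phi ell x0 lambda K v X ->
        NP_form phi ell a b x0 lambda K v X alpha z gamma ->
        alpha = 0]).
Proof.
have [y0 _ y0E] := interior_subset Hx0; rewrite -{x0 Hx0}y0E.
have phi_int := price_density_integrable phi_gt0 phi_E1.
have phi_mass := price_density_mass phi_E1.
have tail t A : {ae P, forall w, A w} -> exists2 w, t < phi w & A w.
  exact: ess_sup_unbounded phi_unbounded.
have low (t : R) A : 0 < t -> {ae P, forall w, A w} ->
    exists2 w, phi w <= t & A w.
  move=> t0; apply: cdf_gt0_meets; apply: le_lt_trans (cdf_ge0 phi (t / 2)) _.
  by apply: cdf_incr; lra.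
have [z [z0 D1 /andP[q0 qz]]] :=
  worst_density_level phi_gt0 phi_E1 lambda_gt0 lambda_lt1.
have [m_ [risk_m m_b m_homo rev_c]] :=
  capital_path Hl HK lambda_gt0 z0 phi_int phi_gt0 tail D1 y0.
have solve (v : R) : 0 < v -> v < K ->
    exists gamma (X : {RV P >-> R}), [/\ 0 < gamma,
    revenue phi ell K z gamma (m_ gamma) = v &
    forall w, X w = claim phi ell K z gamma (m_ gamma) w].
  move=> v0 vK; have [gamma g0 rv] :=
    revenue_onto Hl HK z0 phi_int phi_mass v0 vK m_b rev_c.
  have mX : measurable_fun [set: T] (claim phi ell K z gamma (m_ gamma)).
    exact: (measurable_claim _ _ Hl HK).
  pose X : {RV P >-> R} := HB.pack (claim phi ell K z gamma (m_ gamma))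
    (isMeasurableFun.Build _ _ _ _ _ mX).
  by exists gamma, X.
split.
  move=> v v0 vK; have [gamma [X [g0 rv XE]]] := solve v v0 vK.
  have gK : gamma * z < ell^`()%classic (K - m_ gamma).
    by apply: (claim_unsaturated (phi := phi) Hl HK) => //; rewrite rv.
  have val := claim_value Hl HK lambda_gt0 z0 phi_int phi_gt0 D1 (ltW g0)
    (risk_m gamma) XE.
  rewrite rv in val.
  exists X; split.
  - rewrite -rv.
    exact: (claim_solution Hl HK lambda_gt0 z0 phi_int phi_gt0 D1 (ltW g0)
              (risk_m gamma) XE).
  - move=> Y; rewrite -rv => sY.
    have := claim_unique Hl HK lambda_gt0 z0 phi_int phi_gt0 D1 (ltW g0)
      (risk_m gamma) XE sY.
    by apply: filterS => w ->; rewrite XE.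
  - exists (floor_value ell K z gamma (m_ gamma)),
      (Num.max z (ell^`()%classic (- m_ gamma) / gamma)), gamma.
    split.
    + rewrite (floor_value_ge0 _ Hl HK)/= -rv.
      exact: (floor_lt_revenue Hl HK).
    + by rewrite le_max qz.
    + rewrite val (dloss_floor Hl HK g0 gK) mulfK// gt_eqF// lt_max z0//.
    + by apply: aeW => w; rewrite XE; exact: (claim_form _ Hl HK).
(* The multiplier with gamma0 * z = ell' (y0 - K). As m_ is at most K - y0,
   the claim that belongs to it is zero on [phi <= z]. *)
pose gamma0 := ell^`()%classic (y0 - K) / z.
have g00 : 0 < gamma0 by rewrite divr_gt0// (dloss_gt0 Hl).
have gz gamma : gamma0 * z <= ell^`()%classic (- m_ gamma).
  rewrite divfK ?gt_eqF// (dloss_mono Hl); have := m_b gamma; lra.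
exists (revenue phi ell K z gamma0 (m_ gamma0)); split.
- exact: (revenue_gt0 _ Hl HK).
- by apply: (revenue_ltK Hl HK) => // A; exact: low.
move=> v v0 vhat X alpha z' gamma' sX fX.
have vK : v < K.
  by apply: le_lt_trans vhat _; apply: (revenue_ltK Hl HK) => // A; exact: low.
have [gamma [Xo [g0 rv XE]]] := solve v v0 vK.
rewrite -rv in sX.
have XX := claim_unique Hl HK lambda_gt0 z0 phi_int phi_gt0 D1 (ltW g0)
  (risk_m gamma) XE sX.
have z'0 : 0 < z' by case: fX => _ qz' _ _; exact: lt_le_trans qz'.
have Xa := NP_form_low Hl vK z'0 fX.
have zz : 0 < Num.min z z' by rewrite lt_min z0.
have [w] := low _ _ zz (filterI XX Xa).
rewrite le_min => /andP[wz wz'] [Xw /(_ wz') <-].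
rewrite Xw claim_low//.
have [gm|gm] := leP (gamma * z) (ell^`()%classic (- m_ gamma)).
  exact: (floor_value_eq0 Hl HK).
(* Here alpha would be positive, which is only possible beyond gamma0. *)
have gg : gamma0 <= gamma.
  by rewrite ltW// -(ltr_pM2r z0) (le_lt_trans (gz gamma)).
apply: (floor_value_mono0 Hl HK z0 phi_int phi_gt0 _ gg (m_homo _ _ gg) (gz _)).
  by move=> A; exact: low.
by rewrite rv.
Qed.
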